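(* Let $d\ge1$ be an integer, $\alpha\in(0,d)$, and let $B\subset\mathbb R^d$ be a bounded open domain containing the origin with $0<\inf_{x\in\partial B}|x|\le\sup_{x\in\partial B}|x|<\infty$. Let $\psi\in\Psi(1,d/\alpha)$ and define, for $r\in(1,\infty)$, $$\nu_\psi(r)=\inf_{p\in[1,d/(d-\alpha))}\left[\left(\frac{d}{d-\alpha}-p\right)^{-1+\alpha/d}\psi\!\left(\frac{rp'}{r+p'}\right)\right],\qquad p'=\frac{p}{p-1}.$$ Then there is a constant $C$ (depending only on $\alpha$, $d$ and $B$) such that for every $f\in G(\psi)$ $$\|I^{(B)}_\alpha f\|G(\nu_\psi)\le C\,\|f\|G(\psi).$$
   Context: The truncated Riesz operator is $I^{(B)}_\alpha f(x)=\int_B\frac{f(x-y)\,dy}{|y|^{d-\alpha}}$, $x\in\mathbb R^d$. $|f|_p=\left(\int_{\mathbb R^d}|f|^p\,dx\right)^{1/p}$. $\Psi(a,b)$ is the set of continuous positive functions $\psi$ on $(a,b)$ for which the limits $\psi(a+0),\psi(b-0)$ exist (finite or infinite), with $\inf_{(a,b)}\psi>0$ and $\min\{\psi(a+0),\psi(b-0)\}>0$. For $\psi\in\Psi(a,b)$, $\|f\|G(\psi)=\sup_{p\in(a,b)}|f|_p/\psi(p)$, and $G(\psi)$ is the space of measurable $f:\mathbb R^d\to\mathbb R$ with finite norm. $\|g\|G(\nu_\psi)=\sup_{r\in(1,\infty)}|g|_r/\nu_\psi(r)$. In the definition of $\nu_\psi$, for $p=1$ one has $p'=\infty$ and $rp'/(r+p')$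 is read as $r$; $\psi$ is read as $+\infty$ at arguments outside $(1,d/\alpha)$. *)

(* Defs.v *)
From HB Require Import structures.
From mathcomp Require Import all_boot all_order all_algebra.
From mathcomp Require Import all_classical all_reals all_analysis.

Set Implicit Arguments.
Unset Strict Implicit.
Unset Printing Implicit Defensive.
Import Order.TTheory GRing.Theory Num.Theory.
Import numFieldNormedType.Exports.
Local Open Scope classical_set_scope.
Local Open Scope ring_scope.

(* R^n is 'rV[R]_n. Its measurable sets are generated by the coordinate maps,
   as the library does for n.-tuple R; this is the Borel sigma-algebra. *)
Section measurable_rV.
Context {R : realType} (n : nat).

Let coors : 'I_n -> 'rV[R]_n -> R := fun i x => x ord0 i.

Let rV_set0 : g_sigma_preimage coors set0.
Proof. exact: sigma_algebra0. Qed.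

Let rV_setC A : g_sigma_preimage coors A -> g_sigma_preimage coors (~` A).
Proof. exact: sigma_algebraC. Qed.

Let rV_bigcup (F : (set 'rV[R]_n)^nat) :
  (forall i, g_sigma_preimage coors (F i)) ->
  g_sigma_preimage coors (\bigcup_i (F i)).
Proof. exact: sigma_algebra_bigcup. Qed.

HB.instance Definition _ := @isMeasurable.Build default_measure_display
  'rV[R]_n (g_sigma_preimage coors) rV_set0 rV_setC rV_bigcup.

End measurable_rV.

Section measurable_rV_lemmas.
Context {R : realType}.

Lemma measurable_coord n (i : 'I_n) :
  measurable_fun [set: 'rV[R]_n] (fun x : 'rV[R]_n => x ord0 i).
Proof.
move=> _ Y mY; rewrite setTI; apply: sub_sigma_algebra => /=.
rewrite -bigcup_seq/=; exists i => /=; first by rewrite mem_index_enum.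
by exists Y => //; rewrite setTI.
Qed.

Lemma measurable_fun_rV d (T : measurableType d) n (f : T -> 'rV[R]_n) :
  (forall i, measurable_fun [set: T] (fun x => f x ord0 i)) ->
  measurable_fun [set: T] f.
Proof.
move=> mf _ A mA; rewrite setTI.
have sub : g_sigma_preimage (fun (i : 'I_n) (x : 'rV[R]_n) => x ord0 i) `<=`
    [set A | measurable (f @^-1` A)].
  apply: smallest_sub.
    split=> /=.
    - by rewrite preimage_set0.
    - move=> B /= mB; rewrite setTD preimage_setC; exact: measurableC.
    - move=> F mF /=; rewrite preimage_bigcup; exact: bigcup_measurable.
  rewrite -bigcup_seq => B [i _ [C mC <-]] /=.
  rewrite setTI -[X in measurable X]setTI.
  by have := mf i measurableT C mC; rewrite !setTI.
exact: sub.
Qed.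

Definition rV_cons n (p : R * 'rV[R]_n) : 'rV[R]_n.+1 := row_mx p.1%:M p.2.

Lemma rV_cons0 n (p : R * 'rV[R]_n) : rV_cons p ord0 ord0 = p.1.
Proof.
rewrite /rV_cons mxE; case: splitP => [j _|j //].
by rewrite mxE (ord1 j) eqxx mulr1n.
Qed.

Lemma rV_consS n (p : R * 'rV[R]_n) (i : 'I_n) :
  rV_cons p ord0 (lift ord0 i) = p.2 ord0 i.
Proof.
rewrite /rV_cons mxE; case: splitP => [j|k].
  by rewrite (ord1 j).
by rewrite /= /bump leq0n !add1n => -[ik]; congr (_ _ _); exact/val_inj.
Qed.

Lemma measurable_rV_cons n : measurable_fun [set: R * 'rV[R]_n] (@rV_cons n).
Proof.
apply: measurable_fun_rV => i; case: (unliftP ord0 i) => [j|] ->.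
  under eq_fun do rewrite rV_consS.
  by apply: (measurableT_comp (measurable_coord j)); exact: measurable_snd.
under eq_fun do rewrite rV_cons0.
exact: measurable_fst.
Qed.

Section cons_measure.
Context n (mu : {sigma_finite_measure set 'rV[R]_n -> \bar R}).

Definition cons_measure : set 'rV[R]_n.+1 -> \bar R :=
  pushforward (@lebesgue_measure R \x mu)%E (@rV_cons n).

Let cons_measure0 : cons_measure set0 = 0%E.
Proof. by rewrite /cons_measure /pushforward preimage_set0 measure0. Qed.

Let cons_measure_ge0 A : (0 <= cons_measure A)%E.
Proof.
exact: (@measure_ge0 _ _ _ (@lebesgue_measure R \x mu)%E (@rV_cons n @^-1` A)).
Qed.

Let cons_measure_sigma_additive : semi_sigma_additive cons_measure.
Proof.
exact: (@measure_semi_sigma_additive _ _ _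
  (measure_function_pushforward__canonical__measure_function_Measure
    (@lebesgue_measure R \x mu)%E (@measurable_rV_cons n))).
Qed.

HB.instance Definition _ := isMeasure.Build _ _ _ cons_measure
  cons_measure0 cons_measure_ge0 cons_measure_sigma_additive.

Definition rV_uncons (x : 'rV[R]_n.+1) : R * 'rV[R]_n :=
  (x ord0 ord0, \row_i x ord0 (lift ord0 i)).

Lemma rV_consK : cancel (@rV_cons n) rV_uncons.
Proof.
move=> [a x]; rewrite /rV_uncons rV_cons0; congr pair.
by apply/rowP => i; rewrite mxE rV_consS.
Qed.

Lemma measurable_rV_uncons : measurable_fun [set: 'rV[R]_n.+1] rV_uncons.
Proof.
apply: measurable_fun_pair; first exact: measurable_coord.
apply: measurable_fun_rV => i; under eq_fun do rewrite mxE.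
exact: measurable_coord.
Qed.

Let cons_measure_sigma_finite : sigma_finite setT cons_measure.
Proof.
have /sigma_finiteP[F [TF ndF Foo]] := sigma_finiteT (@lebesgue_measure R).
have /sigma_finiteP[G [TG ndG Goo]] := sigma_finiteT mu.
exists (fun k => rV_uncons @^-1` (F k `*` G k)).
  rewrite -preimage_bigcup (_ : \bigcup_k _ = setT) ?preimage_setT//.
  rewrite -setXTT TF TG predeqE => -[x y]; split.
    by move=> [k _ []/= ? ?]; split; exists k.
  move=> [/= [i _ Fix] [k _ Gky]]; exists (maxn i k) => //; split.
    by move: x Fix; exact/subsetPset/ndF/leq_maxl.
  by move: y Gky; exact/subsetPset/ndG/leq_maxr.
move=> k; have [mF Fk] := Foo k; have [mG Gk] := Goo k; split.
  rewrite -[X in measurable X]setTI; apply: measurable_rV_uncons => //.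
  exact: measurableX.
rewrite /cons_measure /pushforward -comp_preimage.
rewrite (_ : rV_uncons \o _ = id); last by apply/funext => p; exact: rV_consK.
by rewrite preimage_id product_measure1E// lte_mul_pinfty// ge0_fin_numE.
Qed.

HB.instance Definition _ := Measure_isSigmaFinite.Build _ _ _ cons_measure
  cons_measure_sigma_finite.

End cons_measure.

End measurable_rV_lemmas.

Fixpoint lebesgue_rV (R : realType) n :
    {sigma_finite_measure set 'rV[R]_n -> \bar R} :=
  match n with
  | 0 => dirac (0 : 'rV[R]_0)
  | m.+1 => cons_measure (lebesgue_rV R m)
  end.

Lemma lebesgue_rV_box (R : realType) n (A : 'I_n -> set R) :
  (forall i, measurable (A i)) ->
  lebesgue_rV R n [set x : 'rV[R]_n | forall i, A i (x ord0 i)] =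
  (\big[mule/1]_(i < n) lebesgue_measure (A i))%E.
Proof.
elim: n A => [|n IH] A mA.
  rewrite big_ord0 /= /dirac indicE mem_set//=; by case.
rewrite big_ord_recl -IH//.
have mB : measurable [set x : 'rV[R]_n | forall i, A (lift ord0 i) (x ord0 i)].
  rewrite (_ : [set _ | _] = \bigcap_(i in [set: 'I_n])
     ((fun x : 'rV[R]_n => x ord0 i) @^-1` A (lift ord0 i))); last first.
    by apply/seteqP; split => x /= h i; [move=> _; exact: h|exact: h].
  apply: fin_bigcap_measurable => //= i _.
  by rewrite -[X in measurable X]setTI; exact: measurable_coord.
rewrite -product_measure1E//=; last exact: mA.
rewrite /cons_measure /pushforward; congr (product_measure1 _ _ _).
apply/seteqP; split => -[a x] /=.
  move=> h; split; first by have := h ord0; rewrite rV_cons0.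
  by move=> i; have := h (lift ord0 i); rewrite rV_consS.
move=> [h0 hS] i; case: (unliftP ord0 i) => [j|] ->.
  by rewrite rV_consS.
by rewrite rV_cons0.
Qed.

(* The norm `|x| that the library puts on 'rV[R]_n is the sup norm. *)
Definition enorm (R : realType) n (x : 'rV[R]_n) : R :=
  Num.sqrt (\sum_(i < n) x ord0 i ^+ 2).

Definition boundary (T : topologicalType) (A : set T) : set T :=
  closure A `\` interior A.

(* Measurability for the completion of lebesgue_rV. The library's integral is
   a supremum over simple functions below the positive and negative parts, so
   it gives f and its Borel representative g the same integral. *)
Definition lebesgue_measurable_fun (R : realType) n (f : 'rV[R]_n -> R) :=
  exists2 g : 'rV[R]_n -> R, measurable_fun [set: 'rV[R]_n] g &
    {ae lebesgue_rV R n, forall x, f x = g x}.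

Section grand_lebesgue_spaces.
Context {R : realType}.
Local Open Scope ereal_scope.

Definition Psi (a b : R) (psi : R -> R) : Prop :=
  [/\ {in `]a, b[, continuous psi},
      {in `]a, b[, forall p, (0 < psi p)%R},
      0 < ereal_inf [set (psi p)%:E | p in `]a, b[%classic] &
      exists la lb : \bar R,
        [/\ (psi p)%:E @[p --> a^'+] --> la,
            (psi p)%:E @[p --> b^'-] --> lb &
            0 < Order.min la lb]].

Definition Gnorm n (I : set R) (psi : R -> \bar R) (g : 'rV[R]_n -> \bar R) :
    \bar R :=
  ereal_sup [set Lnorm (lebesgue_rV R n) p%:E g / psi p | p in I].

Definition Gspace n (a b : R) (psi : R -> R) (f : 'rV[R]_n -> R) : Prop :=
  lebesgue_measurable_fun f /\
  Gnorm `]a, b[%classic (EFin \o psi) (EFin \o f) < +oo.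

(* Where the integral fails to exist it takes the value +oo - oo = -oo, so the
   norms below see it as infinite. At y = 0 the integrand is 0 (x / 0 = 0). *)
Definition truncated_riesz n (B : set 'rV[R]_n) (alpha : R)
    (f : 'rV[R]_n -> R) (x : 'rV[R]_n) : \bar R :=
  \int[lebesgue_rV R n]_(y in B)
    (f (x - y) / enorm y `^ (n%:R - alpha))%R%:E.

Definition extend_pinfty (a b : R) (psi : R -> R) (p : R) : \bar R :=
  if p \in `]a, b[ then (psi p)%:E else +oo.

(* r p' / (r + p'), where p' may be +oo. *)
Definition young_exponent (r p : R) : R :=
  if hoelder_conjugate p%:E is p'%:E then (r * p' / (r + p'))%R else r.

Definition nu n (alpha : R) (psi : R -> R) (r : R) : \bar R :=
  let D : R := n%:R in
  ereal_inf [set ((D / (D - alpha) - p) `^ (- 1 + alpha / D))%:E *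
               extend_pinfty 1 (D / alpha) psi (young_exponent r p)
            | p in `[1%R, (D / (D - alpha))%R[%classic].

End grand_lebesgue_spaces.

(* Main.v *)
(* The operator is dominated by convolution with the nonnegative kernel
   k = 1_Q |y|^(alpha - d), where Q is a cube containing B. Young's inequality
   with 1 + 1/r = 1/p + 1/q, i.e. q = r p' / (r + p'), gives
   |I f|_r <= |k|_p |f|_q <= |k|_p psi(q) ||f||G(psi). Cutting Q into dyadic
   shells and summing a geometric series, |k|_p^p <= C / (d/(d - alpha) - p);
   the exponent 1/p may then be replaced by (d - alpha)/d = 1 - alpha/d because
   tau^(-(1/p - (d - alpha)/d)) stays bounded as tau = d/(d - alpha) - p tends
   to 0. Taking the infimum over p yields the theorem. *)

Require Import Defs.
From mathcomp Require Import all_boot all_order all_algebra.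
From mathcomp Require Import all_classical all_reals all_analysis.
From mathcomp Require Import measurable_realfun simple_functions.
From mathcomp Require Import ring lra.
Set Implicit Arguments.
Unset Strict Implicit.
Unset Printing Implicit Defensive.
Import Order.TTheory GRing.Theory Num.Theory.
Import numFieldNormedType.Exports.
Local Open Scope classical_set_scope.
Local Open Scope ring_scope.

(** * Monotonicity of integrals of nonnegative functions *)

(* The library's integral of a nonnegative function is a supremum over simple
   functions, so it is monotone without any measurability assumption; this is
   what allows f to be only almost everywhere equal to a Borel function. *)
Section lower_integral.
Local Open Scope ereal_scope.
Context {disp : measure_display} {T : measurableType disp} {R : realType}.
Variable mu : {measure set T -> \bar R}.
Import HBNNSimple.

(** A simple function below [f1], set to 0 on the exceptional null set, lies below [f2] and keeps
    its integral. *)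
Lemma ae_ge0_le_lower_integral (f1 f2 : T -> \bar R) :
  (forall x, 0 <= f1 x) -> (forall x, 0 <= f2 x) ->
  {ae mu, forall x, f1 x <= f2 x} ->
  \int[mu]_x f1 x <= \int[mu]_x f2 x.
Proof.
move=> f10 f20 [N [mN N0 subN]].
rewrite ge0_integralTE// [leRHS]ge0_integralTE//.
apply: ge_ereal_sup => _ /= [h hf1 <-].
have mNC : measurable (~` N) by exact: measurableC.
apply: ereal_sup_ubound => /=; exists (proj_nnsfun h mNC).
  move=> x; rewrite -mrestrict /patch; case: ifPn => // /[1!inE] xN.
  by apply: le_trans (hf1 x) _; apply: contrapT => /subN.
rewrite -2!integralT_nnsfun; apply: ge0_ae_eq_integral => //.
- exact/measurable_EFinP.
- exact/measurable_EFinP.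
- by move=> x _; rewrite lee_fin.
- by move=> x _; rewrite lee_fin.
exists N; split => // x /=; apply: contra_notP => xN _.
by rewrite mindicE mem_set// mulr1.
Qed.

Lemma ge0_le_lower_integral (f1 f2 : T -> \bar R) :
  (forall x, 0 <= f1 x) -> (forall x, f1 x <= f2 x) ->
  \int[mu]_x f1 x <= \int[mu]_x f2 x.
Proof.
move=> f10 f12; apply: ae_ge0_le_lower_integral => //; last exact: aeW.
by move=> x; apply: le_trans (f12 x).
Qed.

(** When [a] and [b] are both +oo their difference is -oo, but then [c] is +oo as well. *)
Lemma ge0_abse_sub_le (a b c : \bar R) :
  0 <= a -> 0 <= b -> a <= c -> b <= c -> `|a - b| <= c.
Proof.
case: a => [a||]//; case: b => [b||]//; case: c => [c||]//=;
  rewrite ?leey// !lee_fin => a0 b0 ac bc.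
by rewrite ler_norml; apply/andP; split; lra.
Qed.

(* When the integral of f does not exist, it is -oo and both the positive and
   the negative part of f have infinite integral. *)
Lemma abse_lower_integral_le (D : set T) (f : T -> \bar R) :
  `|\int[mu]_(x in D) f x| <= \int[mu]_(x in D) `|f x|.
Proof.
rewrite integralE; apply: ge0_abse_sub_le; try exact: integral_ge0.
  rewrite integral_mkcond [leRHS]integral_mkcond.
  apply: ge0_le_lower_integral => x; rewrite /patch; case: ifP => // _.
  by rewrite -[`|f x|]/((abse \o f) x) fune_abse leeDl.
rewrite integral_mkcond [leRHS]integral_mkcond.
apply: ge0_le_lower_integral => x; rewrite /patch; case: ifP => // _.
by rewrite -[`|f x|]/((abse \o f) x) fune_abse leeDr.
Qed.

End lower_integral.

(** * Invariance of Lebesgue measure under the reflections [y |-> x - y] *)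

Section reflection_invariance.
Context {R : realType}.

(** Uniqueness of Lebesgue measure reduces this to half-open intervals; the reflection moves the
    closed end to the other side and keeps the length. *)
Lemma lebesgue_measure_subl (c : R) (A : set R) : measurable A ->
  lebesgue_measure ((fun t => c - t) @^-1` A) = lebesgue_measure A.
Proof.
have mf : measurable_fun setT (fun t : measurableTypeR R => c - t : measurableTypeR R).
  by apply: measurable_funB.
move=> mA; apply/esym.
apply: (@lebesgue_measure_unique R (pushforward (@lebesgue_measure R)
  (fun t : measurableTypeR R => c - t : measurableTypeR R))) => //.
move=> _ [[a b]] _ <-.
rewrite /= /pushforward.
rewrite (_ : (fun t => c - t) @^-1` `]a, b]%classic = `[c - b, c - a[%classic).
  rewrite !lebesgue_measure_itv/= !lte_fin.
  by rewrite ltrD2l ltrN2; case: ifP => // _; congr EFin; lra.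
by apply/seteqP; split => t /=; rewrite !in_itv/= => /andP[]; lra.
Qed.

Lemma measurable_rV_sub n : measurable_fun [set: 'rV[R]_n * 'rV[R]_n]
  (fun z => z.1 - z.2).
Proof.
apply: measurable_fun_rV => i; under eq_fun do rewrite !mxE.
by apply: measurable_funB;
  apply: (measurableT_comp (measurable_coord i)).
Qed.

Lemma measurable_rV_subl n (x : 'rV[R]_n) :
  measurable_fun [set: 'rV[R]_n] (fun y => x - y).
Proof.
exact: (measurableT_comp (@measurable_rV_sub n) (pair1_measurable x)).
Qed.

(** Induction on the dimension: the measure is the image of a product, so by uniqueness of product
    measures it suffices to treat rectangles, one factor at a time. *)
Lemma lebesgue_rV_subl n (x : 'rV[R]_n) (A : set 'rV[R]_n) : measurable A ->
  lebesgue_rV R n ((fun y => x - y) @^-1` A) = lebesgue_rV R n A.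
Proof.
elim: n x A => [|n IH] x A mA.
  congr (lebesgue_rV R 0 _); apply/seteqP; split => y /=;
    by rewrite [x - y](_ : _ = y)//; apply/rowP; case.
rewrite /= /cons_measure /pushforward.
set x0 := x ord0 ord0; set x' := (rV_uncons x).2.
pose T (p : measurableTypeR R * 'rV[R]_n) : measurableTypeR R * 'rV[R]_n := (x0 - p.1, x' - p.2).
have mT : measurable_fun setT T.
  apply: measurable_fun_pair; first exact: measurable_funB.
  exact: (measurableT_comp (measurable_rV_subl x') measurable_snd).
have consT p : rV_cons (T p) = x - rV_cons p.
  apply/rowP => i; rewrite [RHS]mxE [X in _ + X]mxE.
  by case: (unliftP ord0 i) => [j|] ->; rewrite ?rV_consS ?rV_cons0 ?mxE.
have mX : measurable (@rV_cons R n @^-1` A).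
  by rewrite -[X in measurable X]setTI; exact: measurable_rV_cons.
transitivity ((@lebesgue_measure R \x lebesgue_rV R n)%E
    (T @^-1` (@rV_cons R n @^-1` A))).
  by congr (_ _); apply/seteqP; split => p /=; rewrite consT.
apply/esym; apply: (@product_measure_unique _ _ _ _ _ lebesgue_measure
  (lebesgue_rV R n)
  (measure_function_pushforward__canonical__measure_function_Measure
    (@lebesgue_measure R \x lebesgue_rV R n)%E mT) _ _ mX).
move=> C D mC mD; rewrite /= /pushforward.
rewrite (_ : T @^-1` (C `*` D) =
  ((fun t => x0 - t) @^-1` C) `*` ((fun y => x' - y) @^-1` D)); last first.
  by apply/seteqP; split => p.
have mC' : measurable ((fun t : measurableTypeR R => x0 - t) @^-1` C).
  by rewrite -[X in measurable X]setTI; apply: measurable_funB.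
have mD' : measurable ((fun y => x' - y) @^-1` D).
  by rewrite -[X in measurable X]setTI; exact: measurable_rV_subl.
rewrite product_measure1E//; congr (_ * _)%E; last exact: IH.
exact: lebesgue_measure_subl.
Qed.

Lemma ge0_integral_rV_subl n (x : 'rV[R]_n) (F : 'rV[R]_n -> \bar R) :
  measurable_fun setT F -> (forall y, (0 <= F y)%E) ->
  (\int[lebesgue_rV R n]_y F (x - y)%R = \int[lebesgue_rV R n]_y F y)%E.
Proof.
move=> mF F0.
rewrite -[LHS](@ge0_integral_pushforward _ _ _ _ _ _ (measurable_rV_subl x)
  (lebesgue_rV R n) setT)//.
apply: eq_measure_integral => [|mf A mA _]; first exact: measurable_rV_subl.
exact: lebesgue_rV_subl.
Qed.

(** The translation [x |-> x - y] is the reflection [x |-> y - x] followed by [z |-> 0 - z]. *)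
Lemma ge0_integral_rV_subr n (y : 'rV[R]_n) (F : 'rV[R]_n -> \bar R) :
  measurable_fun setT F -> (forall x, (0 <= F x)%E) ->
  (\int[lebesgue_rV R n]_x F (x - y)%R = \int[lebesgue_rV R n]_x F x)%E.
Proof.
move=> mF F0; rewrite -(ge0_integral_rV_subl 0 mF F0).
rewrite -(ge0_integral_rV_subl y (F := fun z => F (0 - z)))//.
  by apply: eq_integral => x _; congr F; rewrite sub0r opprB.
exact: (measurableT_comp mF (measurable_rV_subl 0)).
Qed.

Lemma ae_lebesgue_rV_subl n (x : 'rV[R]_n) (P : 'rV[R]_n -> Prop) :
  {ae lebesgue_rV R n, forall y, P y} ->
  {ae lebesgue_rV R n, forall y, P (x - y)}.
Proof.
move=> [N [mN N0 subN]]; exists ((fun y => x - y) @^-1` N); split.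
- by rewrite -[X in measurable X]setTI; exact: measurable_rV_subl.
- by rewrite -N0; exact: lebesgue_rV_subl.
- by move=> y /= Py; exact: subN.
Qed.

End reflection_invariance.

(** * Hoelder's inequality for powers and Young's convolution inequality *)

Section young.
Local Open Scope ereal_scope.
Context {R : realType}.

(** The endpoints [s = 0] and [s = 1] are included because one exponent in the proof of Young's
    inequality vanishes when [p = 1] or [q = 1]. *)
Lemma ge0_hoelder_powR {disp : measure_display} {T : measurableType disp}
    (mu : {measure set T -> \bar R}) (u v : T -> R) (s : R) :
  measurable_fun setT u -> measurable_fun setT v ->
  (forall x, 0 <= u x)%R -> (forall x, 0 <= v x)%R -> (0 <= s <= 1)%R ->
  \int[mu]_x (u x `^ s * v x `^ (1 - s))%:E <=
  (\int[mu]_x (u x)%:E) `^ s * (\int[mu]_x (v x)%:E) `^ (1 - s).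
Proof.
move=> mu_ mv u0 v0 /andP[].
have iu : 0 <= \int[mu]_x (u x)%:E by apply: integral_ge0 => x _; rewrite lee_fin.
have iv : 0 <= \int[mu]_x (v x)%:E by apply: integral_ge0 => x _; rewrite lee_fin.
rewrite le_eqVlt => /predU1P[<- _|s0].
  rewrite poweRe0 subr0 poweRe1// mul1e.
  by under eq_integral do rewrite powRr0 powRr1// mul1r.
rewrite le_eqVlt => /predU1P[->|s1].
  rewrite subrr poweRe0 poweRe1// mule1.
  by under eq_integral do rewrite powRr0 powRr1// mulr1.
have t0 : (0 < 1 - s)%R by rewrite subr_gt0.
have mus : measurable_fun setT (fun x => u x `^ s)%R.
  exact: (measurableT_comp (measurable_powR _)).
have mvs : measurable_fun setT (fun x => v x `^ (1 - s))%R.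
  exact: (measurableT_comp (measurable_powR _)).
have := @hoelder _ _ _ mu _ _ s^-1 (1 - s)^-1 mus mvs.
rewrite !invr_gt0 => /(_ s0 t0); rewrite !invrK addrC subrK => /(_ erefl).
rewrite Lnorm1 unlock/= !invrK.
under eq_integral do rewrite ger0_norm ?mulr_ge0 ?powR_ge0//.
under [X in _ <= X `^ s * _]eq_integral do
  rewrite ger0_norm ?powR_ge0// -powRrM mulfV ?gt_eqF// powRr1//.
under [X in _ <= _ * X `^ _]eq_integral do
  rewrite ger0_norm ?powR_ge0// -powRrM mulfV ?gt_eqF// powRr1//.
by [].
Qed.

(** Two applications of the two-function case: first [w] is split off with exponent [c], then [u]
    and [v] are separated with the exponents [a] and [b] divided by [1 - c]. *)
Lemma ge0_hoelder3_powR {disp : measure_display} {T : measurableType disp}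
    (mu : {measure set T -> \bar R}) (w u v : T -> R) (c a b : R) :
  measurable_fun setT w -> measurable_fun setT u -> measurable_fun setT v ->
  (forall x, 0 <= w x)%R -> (forall x, 0 <= u x)%R -> (forall x, 0 <= v x)%R ->
  (0 <= c < 1)%R -> (0 <= a)%R -> (0 <= b)%R -> (c + a + b = 1)%R ->
  \int[mu]_x (w x `^ c * (u x `^ a * v x `^ b))%:E <=
  (\int[mu]_x (w x)%:E) `^ c *
  ((\int[mu]_x (u x)%:E) `^ a * (\int[mu]_x (v x)%:E) `^ b).
Proof.
move=> mw mu_ mv w0 u0 v0 /andP[c0 c1] a0 b0 cab.
have s0 : (0 < 1 - c)%R by rewrite subr_gt0.
have sN0 : (1 - c != 0)%R by rewrite gt_eqF.
have bE : (b / (1 - c) = 1 - a / (1 - c))%R.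
  apply: (mulIf sN0); rewrite divfK// mulrBl divfK// mul1r; lra.
have aE : (a = a / (1 - c) * (1 - c))%R by rewrite divfK.
have bE' : (b = b / (1 - c) * (1 - c))%R by rewrite divfK.
have mg : measurable_fun setT
    (fun x => u x `^ (a / (1 - c)) * v x `^ (b / (1 - c)))%R.
  by apply: measurable_funM; apply: (measurableT_comp (measurable_powR _)).
have g0 x : (0 <= u x `^ (a / (1 - c)) * v x `^ (b / (1 - c)))%R.
  by rewrite mulr_ge0// powR_ge0.
have c01 : (0 <= c <= 1)%R by rewrite c0 ltW.
have := ge0_hoelder_powR mu mw mg w0 g0 c01.
under eq_integral do rewrite powRM ?powR_ge0// -!powRrM -aE -bE'.
move=> /le_trans; apply; apply: lee_wpmul2l; first exact: poweR_ge0.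
have := ge0_hoelder_powR mu (s := (a / (1 - c))%R) mu_ mv u0 v0.
rewrite -bE => /(_ _)/[!divr_ge0]//; rewrite ?(ltW s0)//=.
rewrite ler_pdivrMr// mul1r => /(_ ltac:(lra)) h.
rewrite [in leRHS]aE [in leRHS]bE' !poweRrM.
rewrite -poweRM ?poweR_ge0//; apply: gt0_ler_poweR => //.
- exact: ltW.
- by rewrite in_itv/= leey andbT; apply: integral_ge0 => x _; rewrite lee_fin.
- by rewrite in_itv/= leey andbT mule_ge0// poweR_ge0.
by rewrite -!poweRrM.
Qed.

(* With u = k^p and v = h^q, the integrand k(y) h(x - y) is
   (u(y) v(x - y))^(1/r) u(y)^(1/p - 1/r) v(x - y)^(1/q - 1/r), to which
   Hoelder's inequality applies; the r-th power of the bound is then integrated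
   in x by Tonelli's theorem. *)
Lemma young_convolution n (k h : 'rV[R]_n -> R) (p q r : R) :
  measurable_fun setT k -> measurable_fun setT h ->
  (forall x, 0 <= k x)%R -> (forall x, 0 <= h x)%R ->
  (0 < p <= r)%R -> (0 < q <= r)%R -> (1 < r)%R -> (1 + r^-1 = p^-1 + q^-1)%R ->
  Lnorm (lebesgue_rV R n) r%:E
    (fun x : 'rV[R]_n => \int[lebesgue_rV R n]_y (k y * h (x - y)%R)%:E) <=
  Lnorm (lebesgue_rV R n) p%:E (EFin \o k) *
  Lnorm (lebesgue_rV R n) q%:E (EFin \o h).
Proof.
set mu := lebesgue_rV R n.
move=> mk mh k0 h0 /andP[p0 pr] /andP[q0 qr] r1 pqr.
have r0 : (0 < r)%R by lra.
pose u x := (k x `^ p)%R; pose v x := (h x `^ q)%R.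
have mu_ : measurable_fun setT u by exact: (measurableT_comp (measurable_powR _)).
have mv : measurable_fun setT v by exact: (measurableT_comp (measurable_powR _)).
have u0 x : (0 <= u x)%R by exact: powR_ge0.
have v0 x : (0 <= v x)%R by exact: powR_ge0.
have mvx (x : 'rV[R]_n) : measurable_fun [set: 'rV[R]_n] (fun y => v (x - y)%R).
  exact: (measurableT_comp mv (measurable_rV_subl x)).
pose A := \int[mu]_x (u x)%:E; pose H := \int[mu]_x (v x)%:E.
have mev : measurable_fun setT (EFin \o v) by exact/measurable_EFinP.
have ev0 x : 0 <= (EFin \o v) x by rewrite lee_fin.
have intvr (y : 'rV[R]_n) : \int[mu]_x (v (x - y)%R)%:E = H.
  exact: (ge0_integral_rV_subr y mev ev0).
have intvl (x : 'rV[R]_n) : \int[mu]_y (v (x - y)%R)%:E = H.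
  exact: (ge0_integral_rV_subl x mev ev0).
(* The convolution of [u] and [v] carries all the dependence on [x] in the pointwise bound, and its
   integral is [A * H] by Tonelli. *)
pose W (x : 'rV[R]_n) := \int[mu]_y (u y * v (x - y)%R)%:E.
pose a := (p^-1 - r^-1)%R; pose b := (q^-1 - r^-1)%R.
have a0 : (0 <= a)%R by rewrite subr_ge0 lef_pV2.
have b0 : (0 <= b)%R by rewrite subr_ge0 lef_pV2.
have c0 : (0 < r^-1)%R by rewrite invr_gt0.
have c1 : (r^-1 < 1)%R by rewrite invf_lt1.
have A0 : 0 <= A by apply: integral_ge0 => x _; rewrite lee_fin.
have H0 : 0 <= H by apply: integral_ge0 => x _; rewrite lee_fin.
have W0 x : 0 <= W x.
  by apply: integral_ge0 => y _; rewrite lee_fin mulr_ge0.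
have mz : measurable_fun [set: 'rV[R]_n * 'rV[R]_n]
    (fun z => (u z.2 * v (z.1 - z.2)%R)%:E).
  apply/measurable_EFinP; apply: measurable_funM.
    exact: (measurableT_comp mu_ measurable_snd).
  exact: (measurableT_comp mv (@measurable_rV_sub R n)).
have z0 (z : 'rV[R]_n * 'rV[R]_n) : 0 <= (u z.2 * v (z.1 - z.2)%R)%:E.
  by rewrite lee_fin mulr_ge0.
have mW : measurable_fun setT W.
  exact: (measurable_fun_fubini_tonelli_F (m2 := mu) _ mz z0).
have intW : \int[mu]_x W x = A * H.
  rewrite (fubini_tonelli (m1 := mu) (m2 := mu) _ mz z0)/=.
  transitivity (\int[mu]_y ((u y)%:E * H)).
    apply: eq_integral => y _; under eq_integral do rewrite EFinM.
    rewrite ge0_integralZl_EFin// ?intvr//.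
    + by move=> x _; rewrite lee_fin.
    + apply/measurable_EFinP; apply: (measurableT_comp mv).
      exact: (measurableT_comp (@measurable_rV_sub R n) (pair2_measurable y)).
  rewrite ge0_integralZr//; first exact/measurable_EFinP.
  by move=> x _; rewrite lee_fin.
have ptw (x : 'rV[R]_n) :
    \int[mu]_y (k y * h (x - y)%R)%:E <= W x `^ r^-1 * (A `^ a * H `^ b).
  rewrite -(intvl x); have mw : measurable_fun setT (fun y => u y * v (x - y))%R.
    exact: measurable_funM.
  have c01 : (0 <= r^-1 < 1)%R by rewrite c1 ltW.
  have w0 y : (0 <= u y * v (x - y))%R by rewrite mulr_ge0.
  have cab : (r^-1 + a + b = 1)%R by rewrite /a /b; lra.
  apply: le_trans (ge0_hoelder3_powR mu mw mu_ (mvx x) w0 u0 (fun y => v0 _)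
    c01 a0 b0 cab).
  rewrite le_eqVlt; apply/orP; left; apply/eqP; apply: eq_integral => y _.
  congr EFin; rewrite powRM// mulrACA.
  have pow s t : (0 < s)%R -> (0 <= t)%R ->
      ((t `^ s) `^ r^-1 * (t `^ s) `^ (s^-1 - r^-1) = t)%R.
    move=> s0 t0; rewrite -powRD; last first.
      by rewrite addrC subrK invr_eq0 gt_eqF.
    by rewrite addrC subrK -powRrM mulfV ?gt_eqF// powRr1.
  by rewrite /u /v !pow.
rewrite unlock; apply: le_trans (_ : (\int[mu]_x (W x *
    (A `^ a * H `^ b) `^ r)) `^ r^-1 <= _).
  apply: gt0_ler_poweR; rewrite ?(ltW c0)//.
  - by rewrite in_itv/= leey andbT; apply: integral_ge0 => x _; exact: poweR_ge0.
  - rewrite in_itv/= leey andbT; apply: integral_ge0 => x _.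
    by rewrite mule_ge0// poweR_ge0.
  apply: ge0_le_lower_integral => x; first exact: poweR_ge0.
  rewrite gee0_abs; last first.
    by apply: integral_ge0 => y _; rewrite lee_fin mulr_ge0.
  have -> : W x = (W x `^ r^-1) `^ r.
    by rewrite -poweRrM mulVf ?gt_eqF// poweRe1.
  rewrite -poweRM ?mule_ge0 ?poweR_ge0//.
  apply: gt0_ler_poweR; rewrite ?(ltW r0)//.
  - rewrite in_itv/= leey andbT; apply: integral_ge0 => y _.
    by rewrite lee_fin mulr_ge0.
  - by rewrite in_itv/= leey andbT !mule_ge0// poweR_ge0.
rewrite ge0_integralZr//; last by rewrite poweR_ge0.
rewrite intW (poweRM _ (mule_ge0 A0 H0) (poweR_ge0 _ _)).
rewrite -[X in _ * X]poweRrM mulfV ?gt_eqF// poweRe1 ?mule_ge0 ?poweR_ge0//.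
rewrite poweRM// muleACA.
(* The exponents recombine: [r^-1 + a = p^-1] and [r^-1 + b = q^-1], both nonzero. *)
rewrite -!poweRD; last 2 first.
- by apply: add_neq0_poweRD_def; rewrite addrC subrK invr_eq0 gt_eqF.
- by apply: add_neq0_poweRD_def; rewrite addrC subrK invr_eq0 gt_eqF.
rewrite /a /b ![(r^-1 + _)%R]addrC !subrK.
rewrite le_eqVlt; apply/orP; left; apply/eqP.
congr (_ `^ _ * _ `^ _); apply: eq_integral => x _.
- by rewrite /= ger0_norm.
- by rewrite /= ger0_norm.
Qed.

End young.

(** * Dyadic decomposition of the truncated Riesz kernel *)

Section riesz_kernel.
Context {R : realType} (n : nat).
Implicit Types (M t s : R) (y : 'rV[R]_n).

(** A sup-norm cube in place of a Euclidean ball: its measure is an explicit product of interval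
    lengths. *)
Definition box M : set 'rV[R]_n := [set y | forall i, `|y ord0 i| <= M].

Lemma box_itv M :
  box M = [set y : 'rV[R]_n | forall i, `[- M, M]%classic (y ord0 i)].
Proof.
by apply/seteqP; split => y /= h i; have := h i; rewrite /= in_itv/= ler_norml.
Qed.

Lemma measurable_box M : measurable (box M).
Proof.
rewrite (_ : box M = \bigcap_(i in [set: 'I_n])
    ((fun y : 'rV[R]_n => y ord0 i) @^-1` `[- M, M]%classic)).
  apply: fin_bigcap_measurable => //= i _.
  by rewrite -[X in measurable X]setTI; exact: measurable_coord.
by rewrite box_itv; apply/seteqP; split => y /= h i; [move=> _; exact: h|exact: h].
Qed.

Lemma lebesgue_rV_cube M : 0 <= M ->
  lebesgue_rV R n (box M) = ((2 * M) ^+ n)%:E.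
Proof.
move=> M0; rewrite box_itv (lebesgue_rV_box (A := fun=> `[- M, M]%classic))//.
rewrite (eq_bigr (fun=> (2 * M)%:E)) => [|i _].
  by rewrite -[in RHS](card_ord n) -prodr_const (big_morph EFin (@EFinM R) erefl).
rewrite lebesgue_measure_itv/= lte_fin; case: ltP => h.
  by rewrite -EFinB; congr EFin; lra.
by congr EFin; lra.
Qed.

Lemma ler_coord_enorm y i : `|y ord0 i| <= enorm y.
Proof.
rewrite -sqrtr_sqr /enorm ler_sqrt ?sumr_ge0// => [|j _]; last exact: sqr_ge0.
by rewrite (bigD1 i)//= lerDl sumr_ge0// => j _; exact: sqr_ge0.
Qed.

Lemma enorm_ge0 y : 0 <= enorm y. Proof. exact: sqrtr_ge0. Qed.

Lemma enorm0 : enorm (0 : 'rV[R]_n) = 0.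
Proof. by rewrite /enorm big1 ?sqrtr0// => i _; rewrite mxE expr0n. Qed.

Lemma measurable_enorm : measurable_fun [set: 'rV[R]_n] (@enorm R n).
Proof.
have ms : measurable_fun setT (@Num.sqrt R).
  exact: continuous_measurable_fun (@sqrt_continuous R).
apply: (measurableT_comp ms).
apply: measurable_sum => i; apply: measurable_funX; exact: measurable_coord.
Qed.

Definition riesz_kernel M t y : R := \1_(box M) y / enorm y `^ t.

Lemma riesz_kernel_ge0 M t y : 0 <= riesz_kernel M t y.
Proof. by rewrite divr_ge0// powR_ge0. Qed.

Lemma measurable_riesz_kernel M t : measurable_fun setT (riesz_kernel M t).
Proof.
apply: measurable_funM; first exact: measurable_indic (measurable_box M).
under eq_fun do rewrite -powRN.
exact: (measurableT_comp (measurable_powR _) measurable_enorm).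
Qed.

(** Some coordinate of [y] is nonzero, so [y] leaves the shrinking cubes; [j + 1] is the first index
    at which it is outside, and the coordinate that violates the bound there is at most
    [enorm y]. *)
Lemma box_shell M y : 0 < M -> box M y -> y != 0 ->
  exists j, box (M / 2 ^+ j) y /\ M / 2 ^+ j.+1 <= enorm y.
Proof.
move=> M0 yM y0.
have [i yi0] : exists i, y ord0 i != 0.
  apply/existsP; rewrite -negb_forall; apply: contra y0 => /forallP h.
  by apply/eqP/rowP => i; rewrite mxE; apply/eqP.
have exk : exists k, ~~ `[< box (M / 2 ^+ k) y >].
  have e0 : 0 < `|y ord0 i| / M by rewrite divr_gt0// normr_gt0.
  have [k _ /(_ k (leqnn k))/=] := near_infty_natSinv_expn_lt (PosNum e0).
  rewrite ltr_pdivlMr// mul1r mulrC => h; exists k; apply/asboolPn => /(_ i).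
  by rewrite leNgt h.
case: (ex_minnP exk) => -[|j] /asboolPn yk kmin.
  by exfalso; apply: yk; rewrite expr0 divr1.
exists j; split.
  by apply: contrapT => /asboolPn/kmin; rewrite ltnn.
move/existsNP : yk => [i' /negP]; rewrite -ltNge => /ltW h.
exact: le_trans h (ler_coord_enorm _ _).
Qed.

(* An upper bound for the integral of enorm^(-s) on the j-th dyadic shell. *)
Let shell M s j : R := (M / 2 ^+ j.+1) `^ (- s) * (2 * (M / 2 ^+ j)) ^+ n.

(** The volume contributes [2 ^ (- j n)] and the kernel [2 ^ (j s)], so the ratio is below 1 as soon
    as [s < n]. *)
Lemma shellE M s j : 0 < M ->
  shell M s j = geometric ((M / 2) `^ (- s) * (2 * M) ^+ n)
    (2 `^ (- (n%:R - s))) j.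
Proof.
move=> M0; rewrite /geometric /shell/=.
have -> : M / 2 ^+ j.+1 = (M / 2) * 2 `^ (- j%:R).
  by rewrite powR_invn// exprS invfM mulrA.
have -> : 2 * (M / 2 ^+ j) = 2 * M * 2 `^ (- j%:R) by rewrite powR_invn// mulrA.
rewrite powRM ?powR_ge0 ?divr_ge0 ?ltW// exprMn mulrACA; congr (_ * _).
rewrite -!powR_mulrn ?powR_ge0// -!powRrM -powRD; last first.
  by rewrite pnatr_eq0 implybT.
by congr (_ `^ _); lra.
Qed.

Lemma integral_riesz_kernel_powR M t p : 0 < M -> 0 < t -> 0 < p ->
  t * p < n%:R ->
  (\int[lebesgue_rV R n]_y (riesz_kernel M t y `^ p)%:E <=
   ((M / 2) `^ (- (t * p)) * (2 * M) ^+ n /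
    (1 - 2 `^ (- (n%:R - t * p))))%:E)%E.
Proof.
set s := t * p => M0 t0 p0 sn.
have rho0 j : 0 < M / 2 ^+ j by rewrite divr_gt0// exprn_gt0.
(* On the [j]-th shell [enorm y >= M / 2 ^ (j + 1)], so the coefficient dominates the kernel's
   [p]-th power; the indicator is that of the whole cube, which contains the shell. *)
pose g j y : \bar R := ((M / 2 ^+ j.+1) `^ (- s) * \1_(box (M / 2 ^+ j)) y)%:E.
have mg j : measurable_fun setT (g j).
  apply/measurable_EFinP; apply: measurable_funM => //.
  exact: measurable_indic (measurable_box _).
have g0 j y : (0 <= g j y)%E by rewrite lee_fin mulr_ge0// powR_ge0.
apply: le_trans (_ : \int[lebesgue_rV R n]_y (\sum_(0 <= j <oo) g j y) <= _)%E.
  apply: ge0_le_lower_integral => y; first by rewrite lee_fin powR_ge0.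
  have [yM|yM] := boolP (y \in box M); last first.
    rewrite /riesz_kernel indicE (negbTE yM) mul0r powR0 ?gt_eqF//.
    exact: nneseries_ge0.
  (* The origin lies in no shell, but the kernel is 0 there, by the conventions [0 ^ t = 0] for [t]
     nonzero and [0^-1 = 0]. *)
  have [->|y0] := eqVneq y 0.
    rewrite /riesz_kernel enorm0 powR0 ?gt_eqF// invr0 mulr0 powR0 ?gt_eqF//.
    exact: nneseries_ge0.
  have [j [yj jy]] := box_shell M0 (set_mem yM) y0.
  apply: le_trans (_ : g j y <= _)%E; last first.
    apply: le_trans (nneseries_lim_ge j.+1 _) => //.
    by rewrite big_nat_recr//= leeDr// sume_ge0.
  rewrite lee_fin /riesz_kernel indicE yM indicE mem_set// mulr1 mul1r.
  rewrite -powRN -powRrM mulNr -/s !powRN lef_pV2 ?posrE ?powR_gt0//.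
    apply: ge0_ler_powR; rewrite ?nnegrE ?(ltW (rho0 _)) ?enorm_ge0//.
    by rewrite mulr_ge0// ltW.
  exact: lt_le_trans jy.
rewrite integral_nneseries//.
apply: lime_le; first by apply: is_cvg_nneseries => j _ _; apply: integral_ge0.
apply: nearW => N.
apply: le_trans (_ : (series (geometric ((M / 2) `^ (- s) * (2 * M) ^+ n)
    (2 `^ (- (n%:R - s)))) N)%:E <= _)%E.
  rewrite /series/= -sumEFin; apply: lee_sum => j _.
  rewrite /g; under eq_integral do rewrite EFinM.
  rewrite ge0_integralZl_EFin//; last 2 first.
  - by apply/measurable_EFinP; exact: measurable_indic (measurable_box _).
  - exact: powR_ge0.
  rewrite integral_indic//; last exact: measurable_box.
  rewrite setIT [X in (_ * X <= _)%E](lebesgue_rV_cube (ltW (rho0 j))).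
  by rewrite -EFinM lee_fin -[leRHS](shellE s j M0).
rewrite lee_fin; apply: geometric_le_lim.
- by rewrite mulr_ge0 ?powR_ge0// exprn_ge0// mulr_ge0// ltW.
- by rewrite powR_gt0.
- rewrite ger0_norm ?powR_ge0// powRN invf_lt1 ?powR_gt0//.
  have := @gt0_ltr_powR R (n%:R - s); rewrite subr_gt0 => /(_ sn 1 2).
  by rewrite powR1 !nnegrE ltr1n; apply.
Qed.

End riesz_kernel.

(** * Growth of the kernel norm as [p] approaches the critical exponent *)

Section riesz_kernel_norm.
Context {R : realType}.

(** Controls the geometric sum when its ratio tends to 1. The left side is [z / (z - 1)] at
    [z = 2 ^ x], decreasing in [z], and [z >= 1 + x ln 2]; then [x <= a] bounds the numerator. *)
Lemma inv_1B_powR2N (a x : R) : 0 < x <= a ->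
  (1 - 2 `^ (- x))^-1 <= (1 + a * ln 2) / (x * ln 2).
Proof.
move=> /andP[x0 xa]; have l0 : 0 < ln (2 : R) by rewrite ln_gt0// ltr1n.
have xl : 0 < x * ln 2 by rewrite mulr_gt0.
have e : 2 `^ x >= 1 + x * ln 2 by rewrite /powR pnatr_eq0/= expR_ge1Dx.
have e0 : 0 < 2 `^ x by rewrite powR_gt0.
rewrite powRN.
have -> : (1 - (2 `^ x)^-1)^-1 = 2 `^ x / (2 `^ x - 1).
  by field; rewrite !gt_eqF//; lra.
rewrite ler_pdivrMr; last lra.
rewrite mulrAC ler_pdivlMr//.
have : x * ln 2 <= a * ln 2 by rewrite ler_pM2r.
nra.
Qed.

(** With [tau = q - p], the logarithms differ by [(p^-1 - q^-1) * - ln tau]. Since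
    [- ln tau <= tau^-1] and [p^-1 - q^-1 = tau / (p q)], this is at most [(p q)^-1 <= 1]. *)
Lemma powR_inv_le (p q : R) : 1 <= p < q ->
  (q - p) `^ (- p^-1) <= expR 1 * (q - p) `^ (- q^-1).
Proof.
move=> /andP[p1 pq]; have t0 : 0 < q - p by rewrite subr_gt0.
have p0 : 0 < p by lra. have q0 : 0 < q by lra.
rewrite /powR (gt_eqF t0) -expRD ler_expR.
have h : - ln (q - p) <= (q - p)^-1.
  rewrite -lnV ?posrE//; have := @le_ln1Dx R ((q - p)^-1 - 1).
  rewrite [1 + _]addrC subrK => h; apply: le_trans (h _) _; last lra.
  by rewrite ltrBrDl subrr invr_gt0.
have -> : - p^-1 * ln (q - p) = - q^-1 * ln (q - p) + (p^-1 - q^-1) * - ln (q - p).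
  by ring.
rewrite addrC lerD2r.
have d0 : 0 <= p^-1 - q^-1 by rewrite subr_ge0 lef_pV2 ?posrE// ltW.
apply: le_trans (ler_wpM2l d0 h) _.
have -> : (p^-1 - q^-1) / (q - p) = (p * q)^-1.
  by field; rewrite !gt_eqF//.
by rewrite invf_le1 ?mulr_gt0// mulr_ege1//; lra.
Qed.

Lemma riesz_kernel_Lnorm (n : nat) (M alpha : R) :
  2 <= M -> 0 < alpha < n%:R ->
  exists2 C : R, 0 <= C & forall p, 1 <= p < n%:R / (n%:R - alpha) ->
    (Lnorm (lebesgue_rV R n) p%:E (EFin \o @riesz_kernel R n M (n%:R - alpha)) <=
     (C * (n%:R / (n%:R - alpha) - p) `^ (- 1 + alpha / n%:R))%:E)%E.
Proof.
move=> M2 /andP[a0 an]; set t := n%:R - alpha; set q := n%:R / t.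
have n0 : 0 < n%:R :> R by lra.
have t0 : 0 < t by rewrite subr_gt0.
have l0 : 0 < ln (2 : R) by rewrite ln_gt0// ltr1n.
(* The summand 1 ensures [C1 >= 1], so that [C1] bounds its own [p]-th root for every [p >= 1]. *)
pose C1 : R := 1 + (2 * M) ^+ n * ((1 + alpha * ln 2) / (t * ln 2)).
have C10 : 0 <= (2 * M) ^+ n * ((1 + alpha * ln 2) / (t * ln 2)).
  have al0 : 0 < alpha * ln 2 by exact: mulr_gt0.
  have tl0 : 0 < t * ln 2 by exact: mulr_gt0.
  by apply: mulr_ge0; [apply: exprn_ge0|apply: divr_ge0]; lra.
have C11 : 1 <= C1 by rewrite lerDl.
exists (C1 * expR 1); first by rewrite mulr_ge0 ?expR_ge0//; lra.
move=> p /andP[p1 pq].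
have p0 : 0 < p by lra.
have tau0 : 0 < q - p by rewrite subr_gt0.
(* The exponent in the geometric ratio is proportional to the distance from [p] to the critical
   exponent [q]. *)
have dE : n%:R - t * p = t * (q - p) by rewrite mulrBr [t * q]mulrC divfK// gt_eqF.
have tpn : t * p < n%:R by rewrite -subr_gt0 dE mulr_gt0.
have M0 : 0 < M by lra.
have qE : - 1 + alpha / n%:R = - q^-1.
  by rewrite /q invf_div /t; field; rewrite gt_eqF.
have hA : (\int[lebesgue_rV R n]_y (riesz_kernel M t y `^ p)%:E <=
    (C1 / (q - p))%:E)%E.
  apply: le_trans (integral_riesz_kernel_powR M0 t0 p0 tpn) _.
  rewrite lee_fin dE.
  have d0 : 0 < t * (q - p) <= alpha.
    by rewrite mulr_gt0//= -dE /t; nra.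
  apply: le_trans (_ : (2 * M) ^+ n *
    ((1 + alpha * ln 2) / (t * (q - p) * ln 2)) <= _); last first.
    rewrite /C1 [leRHS]mulrDl mul1r; apply: le_trans (_ : (2 * M) ^+ n *
      ((1 + alpha * ln 2) / (t * ln 2)) / (q - p) <= _); last first.
      by rewrite lerDr invr_ge0 ltW.
    rewrite le_eqVlt; apply/orP; left; apply/eqP; field.
    by rewrite !gt_eqF.
  (* Here [2 <= M] makes the bound uniform in [p]. *)
  have p2 : (M / 2) `^ (- (t * p)) <= 1.
    rewrite powRN invf_le1 ?powR_gt0 ?divr_gt0//.
    rewrite -[leLHS](_ : (M / 2) `^ 0 = 1); last by rewrite powRr0.
    by apply: ler_powR; [lra | rewrite mulr_ge0// ltW].
  have := inv_1B_powR2N d0; set z := (1 - _)^-1 => hz.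
  have z0 : 0 <= z.
    rewrite invr_ge0 subr_ge0 powRN invf_le1 ?powR_gt0//.
    rewrite -[leLHS](_ : 2 `^ 0 = 1); last by rewrite powRr0.
    by apply: ler_powR; [rewrite ler1n | case/andP: d0 => /ltW].
  apply: ler_pM => //; first by rewrite mulr_ge0 ?powR_ge0 ?exprn_ge0; lra.
  by rewrite ler_piMl ?exprn_ge0//; lra.
rewrite unlock /=.
under eq_integral do rewrite ger0_norm ?riesz_kernel_ge0//.
apply: le_trans (_ : (C1 / (q - p))%:E `^ p^-1 <= _)%E.
  apply: gt0_ler_poweR => //.
  - by rewrite invr_ge0 ltW.
  - by rewrite in_itv/= leey andbT; apply: integral_ge0 => y _; rewrite lee_fin powR_ge0.
  - by rewrite in_itv/= leey andbT lee_fin divr_ge0; lra.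
rewrite poweR_EFin lee_fin powRM ?invr_ge0; try lra.
rewrite -[_^-1 in X in _ * X <= _]powR_inv1 ?(ltW tau0)// -powRrM mulN1r qE.
(* The factors are compared separately: [C1] absorbs its root, and [expR 1] pays for replacing the
   exponent [- p^-1] by [- q^-1]. *)
rewrite -mulrA; apply: ler_pM; rewrite ?powR_ge0//.
  by apply: ler1_powR => //; rewrite invf_le1.
by apply: powR_inv_le; rewrite p1.
Qed.

End riesz_kernel_norm.

(** * Domination of the truncated Riesz operator by a convolution *)

Lemma ge0_le_Lnorm {R : realType} {disp : measure_display}
    {T : measurableType disp} (mu : {measure set T -> \bar R}) (r : R)
    (f g : T -> \bar R) : 0 < r ->
  {ae mu, forall x, `|f x| <= `|g x|}%E ->
  (Lnorm mu r%:E f <= Lnorm mu r%:E g)%E.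
Proof.
move=> r0 fg; rewrite unlock.
have ge0i h : (0 <= \int[mu]_x (`|h x| `^ r))%E.
  by apply: integral_ge0 => x _; exact: poweR_ge0.
apply: gt0_ler_poweR; rewrite ?invr_ge0 ?(ltW r0)// ?in_itv/= ?leey ?andbT//.
apply: ae_ge0_le_lower_integral => [x|x|]; try exact: poweR_ge0.
apply: filterS fg => x fg.
by apply: gt0_ler_poweR; rewrite ?(ltW r0)// ?in_itv/= ?leey ?andbT//.
Qed.

(** For [p > 1] the inverse of the Young exponent is [r^-1 + 1 - p^-1]; for [p = 1] the conjugate is
    +oo and the exponent is [r] itself. *)
Lemma young_exponentV {R : realType} (r p : R) : 1 < r -> 1 <= p ->
  1 + r^-1 = p^-1 + (young_exponent r p)^-1.
Proof.
move=> r1 p1; rewrite /young_exponent.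
have [->|pN1] := eqVneq p 1; first by rewrite hoelder_conjugate1 invr1.
have p1' : 1 < p by rewrite lt_def pN1.
rewrite /hoelder_conjugate /= eqe gt_eqF; last lra.
rewrite -EFinB inver subr_eq0 (negbTE pN1) -EFinM.
by field; rewrite !gt_eqF//= ; nra.
Qed.

Section truncated_riesz_bounds.
Context {R : realType} (n : nat) (alpha : R) (B : set 'rV[R]_n) (M : R).
Hypothesis BM : B `<=` box M.

(** Reflections preserve null sets, so [f (x - y) = g (x - y)] for almost every [y], for each fixed
    [x]; enlarging [B] to the cube only increases the integral of absolute values. *)
Lemma abse_truncated_riesz_le (f g : 'rV[R]_n -> R) (x : 'rV[R]_n) :
  {ae lebesgue_rV R n, forall y, f y = g y} ->
  (`|truncated_riesz B alpha f x| <=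
   \int[lebesgue_rV R n]_y
     (riesz_kernel M (n%:R - alpha) y * `|g (x - y)|)%:E)%E.
Proof.
move=> fg; apply: le_trans (abse_lower_integral_le _ _ _) _.
rewrite integral_mkcond; apply: ae_ge0_le_lower_integral.
- by move=> y; rewrite /patch; case: ifP.
- by move=> y; rewrite lee_fin mulr_ge0// riesz_kernel_ge0.
apply: filterS (ae_lebesgue_rV_subl x fg) => y fgy.
rewrite /patch; case: ifPn => [/set_mem yB|_]; last first.
  by rewrite lee_fin mulr_ge0// riesz_kernel_ge0.
rewrite /riesz_kernel indicE mem_set ?mul1r; last exact: BM.
by rewrite /= lee_fin normrM fgy mulrC normfV (ger0_norm (powR_ge0 _ _)).
Qed.

Lemma Lnorm_truncated_riesz_le (f : 'rV[R]_n -> R) (p r : R) :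
  lebesgue_measurable_fun f -> 1 <= p -> 1 < r -> 1 < young_exponent r p ->
  (Lnorm (lebesgue_rV R n) r%:E (truncated_riesz B alpha f) <=
   Lnorm (lebesgue_rV R n) p%:E
     (EFin \o @riesz_kernel R n M (n%:R - alpha)) *
   Lnorm (lebesgue_rV R n) (young_exponent r p)%:E (EFin \o f))%E.
Proof.
move=> [g mg fg] p1 r1; have := young_exponentV r1 p1.
set q := young_exponent r p => pqr q1.
have p0 : 0 < p by lra. have q0 : 0 < q by lra. have r0 : 0 < r by lra.
have pV : p^-1 <= 1 by rewrite invf_le1.
have qV : q^-1 < 1 by rewrite invf_lt1.
(* The relation [1 + r^-1 = p^-1 + q^-1] with [q^-1 < 1] gives [r^-1 <= p^-1]; symmetrically for
   [q]. *)
have pr : 0 < p <= r by rewrite p0 -lef_pV2 ?posrE//; lra.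
have qr : 0 < q <= r by rewrite q0 -lef_pV2 ?posrE//; lra.
set k := @riesz_kernel R n M (n%:R - alpha).
have k0 x : 0 <= k x by exact: riesz_kernel_ge0.
have h0 x : 0 <= (fun y => `|g y|) x by [].
have mh : measurable_fun setT (fun y => `|g y|).
  exact: measurableT_comp.
apply: le_trans (_ : Lnorm (lebesgue_rV R n) r%:E (fun x : 'rV[R]_n =>
    \int[lebesgue_rV R n]_y (k y * `|g (x - y)%R|)%:E) <= _)%E.
  apply: ge0_le_Lnorm => //; apply: aeW => x.
  rewrite [leRHS]gee0_abs; first exact: abse_truncated_riesz_le.
  by apply: integral_ge0 => y _; rewrite lee_fin mulr_ge0.
apply: le_trans (young_convolution (measurable_riesz_kernel _ _) mh k0 h0 pr qr
  r1 pqr) _.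
apply: lee_wpmul2l; first exact: Lnorm_ge0.
apply: ge0_le_Lnorm => //; apply: filterS fg => x fgx.
by rewrite /= fgx normr_id.
Qed.

End truncated_riesz_bounds.

(** The norm on row vectors is the sup norm, so a norm bound is a cube; [M] is taken at least 2 for
    the kernel estimate. *)
Lemma bounded_set_box {R : realType} n (B : set 'rV[R]_n) : bounded_set B ->
  exists2 M, 2 <= M & B `<=` box M.
Proof.
move=> bB; have [M [M2 BM]] : exists M : R, 2 <= M /\ forall x, B x -> `|x| <= M.
  near (@pinfty_nbhs R) => M; exists M; split; near: M => //.
  exact: nbhs_pinfty_ge.
exists M => // x /BM xM i; apply: le_trans xM.
rewrite [leRHS]/Num.norm /= mx_normrE; apply/bigmax_geP; right => /=.
by exists (ord0, i).
Unshelve. all: by end_near. Qed.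

(** * Passage to the grand Lebesgue norms *)

Theorem theorem5 (R : realType) (d : nat) (alpha : R) (B : set 'rV[R]_d)
  (d_ge1 : (1 <= d)%N) (alpha_gt0 : 0 < alpha) (alpha_ltd : alpha < d%:R)
  (B_open : open B) (B_connected : connected B) (B_bounded : bounded_set B)
  (B_0 : B 0)
  (B_inf : (0 < ereal_inf [set (enorm x)%:E | x in boundary B])%E)
  (B_inf_sup : (ereal_inf [set (enorm x)%:E | x in boundary B] <=
                ereal_sup [set (enorm x)%:E | x in boundary B])%E)
  (B_sup : (ereal_sup [set (enorm x)%:E | x in boundary B] < +oo)%E) :
  exists C : R, forall psi : R -> R, Psi 1 (d%:R / alpha) psi ->
    forall f : 'rV[R]_d -> R, Gspace 1 (d%:R / alpha) psi f ->
      (Gnorm `]1%R, +oo[%classic (nu d alpha psi) (truncated_riesz B alpha f) <=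
       C%:E * Gnorm `]1%R, (d%:R / alpha)%R[%classic (EFin \o psi) (EFin \o f))%E.
Proof.
have [M M2 BM] := bounded_set_box B_bounded.
have aD : 0 < alpha < d%:R by rewrite alpha_gt0.
have [C C0 kC] := riesz_kernel_Lnorm M2 aD.
exists C => psi [_ psi0 _ _] f [mf Gfoo].
set G := Gnorm _ _ (EFin \o f) in Gfoo *.
have D1 : 1 < d%:R / alpha by rewrite ltr_pdivlMr// mul1r.
have G0 : (0 <= G)%E.
  (* A midpoint, showing that the supremum defining [G] is over a nonempty set of nonnegative
     values. *)
  pose q0 : R := (1 + d%:R / alpha) / 2.
  have q0D : q0 \in `]1, (d%:R / alpha)[ by rewrite in_itv/= /q0; lra.
  have h : (0 <= Lnorm (lebesgue_rV R d) q0%:E (EFin \o f) / (psi q0)%:E)%E.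
    by rewrite mule_ge0 ?Lnorm_ge0// inve_ge0 lee_fin ltW// psi0.
  by apply: (le_trans h); apply: ereal_sup_ubound; exists q0.
have Gfin : G \is a fin_num by rewrite ge0_fin_numE.
have fG q : q \in `]1, (d%:R / alpha)[ ->
    (Lnorm (lebesgue_rV R d) q%:E (EFin \o f) <= G * (psi q)%:E)%E.
  move=> qD; rewrite -lee_pdivrMr ?psi0//.
  apply: ereal_sup_ubound; exists q => //=.
  by rewrite inver gt_eqF ?psi0.
have CG0 : 0 <= C * fine G by rewrite mulr_ge0// fine_ge0.
rewrite -(fineK Gfin) -EFinM.
apply: ge_ereal_sup => _ /= [r /[!in_itv]/= /andP[r1 _] <-].
set E := Lnorm _ _ _; have E0 : (0 <= E)%E by exact: Lnorm_ge0.
pose W p : \bar R :=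
  (((d%:R / (d%:R - alpha) - p) `^ (- 1 + alpha / d%:R))%:E *
   extend_pinfty 1 (d%:R / alpha) psi (young_exponent r p))%E.
(* Finiteness of [W p] forces the Young exponent into []1, d / alpha[]: elsewhere [extend_pinfty] is
   +oo and the other factor is positive. *)
have EW p : 1 <= p < d%:R / (d%:R - alpha) -> (W p < +oo)%E ->
    (E <= (C * fine G)%:E * W p)%E.
  move=> pD; rewrite /W /extend_pinfty; set q := young_exponent r p.
  case: ifPn => [qD _|_]; last first.
    by rewrite gt0_muley ?ltxx// lte_fin powR_gt0// subr_gt0; case/andP: pD.
  have [p1 _] := andP pD.
  have q1 : 1 < q by move: qD; rewrite in_itv/= => /andP[].
  apply: le_trans (Lnorm_truncated_riesz_le alpha BM mf p1 r1 q1) _.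
  apply: le_trans (lee_pmul (Lnorm_ge0 _ _ _) (Lnorm_ge0 _ _ _)
    (kC _ pD) (fG _ qD)) _.
  by rewrite -(fineK Gfin) -!EFinM lee_fin le_eqVlt; apply/orP; left; apply/eqP; ring.
(* The inverse of +oo is 0, so the quotient vanishes. *)
have [nuy|nuoo] := eqVneq (nu d alpha psi r) +oo%E.
  by rewrite nuy invey mule0 lee_fin.
have nu0 : (0 <= nu d alpha psi r)%E.
  apply: le_ereal_inf_tmp => _ [p _ <-].
  rewrite mule_ge0 ?lee_fin ?powR_ge0// /extend_pinfty.
  by case: ifPn => // qD; rewrite lee_fin ltW// psi0.
have nuE : (E <= (C * fine G)%:E * nu d alpha psi r)%E.
  (* When the constant is 0 one cannot divide by it; a single [p] with [W p] finite then already
     gives [E <= 0]. *)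
  have [CG|CG] := eqVneq (C * fine G) 0.
    have : (nu d alpha psi r < +oo)%E by rewrite ltey.
    move=> /ereal_inf_lt[_ [p pD <-] Wp].
    by move: (EW p pD Wp); rewrite CG !mul0e.
  have CGgt0 : 0 < C * fine G by rewrite lt_def CG.
  rewrite -lee_pdivrMl//; apply: le_ereal_inf_tmp => _ [p pD <-].
  rewrite lee_pdivrMl// -/(W p).
  have [->|Wp] := eqVneq (W p) +oo%E; first by rewrite gt0_muley ?leey.
  by apply: EW; rewrite ?ltey.
(* If the infimum is 0, then [E = 0], and the product of 0 with the inverse of 0 is 0. *)
have [nuz|nun0] := eqVneq (nu d alpha psi r) 0%E.
  have -> : E = 0%E by apply/eqP; rewrite eq_le E0 andbT; rewrite nuz mule0 in nuE.
  by rewrite mul0e lee_fin.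
have nufin : nu d alpha psi r \is a fin_num by rewrite ge0_fin_numE// ltey.
have nugt0 : 0 < fine (nu d alpha psi r) by rewrite fine_gt0// lt0e nun0 nu0 ltey.
rewrite -(fineK nufin) inver gt_eqF// lee_pdivrMr//.
by rewrite fineK.
Qed.
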